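(* Let $\mathbf{H}=(H,m,e,\delta,\varepsilon)$ be a $\tau$-bimonad on a category $\mathbb{A}$, where $\tau:HH\to HH$ is a double entwining. Then the composite $$\tilde\tau: HH\xrightarrow{\ \delta H\ }HHH\xrightarrow{\ H\tau\ }HHH\xrightarrow{\ mH\ }HH$$ is a mixed distributive law from the monad $\underline H=(H,m,e)$ to the comonad $\overline H=(H,\delta,\varepsilon)$. Thus $\mathbf{H}$ is a bimonad with mixed distributive law $\tilde\tau$.
   Context: Composition of functors is written by juxtaposition, $\cdot$ is vertical composition, $H\alpha,\alpha H$ are whiskerings, and $\alpha\beta$ is the horizontal composite. Let $(H,m,e)$ be a monad and $(H,\delta,\varepsilon)$ a comonad on $\mathbb{A}$ with the same underlying endofunctor $H$. Mixed distributive law from the monad to the comonad: a natural transformation $\lambda:HH\to HH$ with $\lambda\cdot eH=He$, $\varepsilon H\cdot\lambda=H\varepsilon$, $\delta H\cdot\lambda=H\lambda\cdot\lambda H\cdot H\delta$, $\lambda\cdot mH=Hm\cdot\lambda H\cdot H\lambda$. Mixed distributive law from the comonad to the monad: $\lambda\cdot He=eH$, $H\varepsilon\cdot\lambda=\varepsilon H$, $H\delta\cdot\lambda=\lambda H\cdot H\lambda\cdot\delta H$, $\lambda\cdot Hm=mH\cdot H\lambda\cdot\lambda H$. A double entwining is a natural transformation $\tau:HH\to HH$ which is both of these. Given a double entwining $\tau$, $\mathbf{H}$ is a $\tau$-bimonad if $\delta\cdot m=mm\cdot H\tau H\cdot\delta\delta$, $\varepsilon\cdot m=\varepsilon\cdot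 H\varepsilon$, $\delta\cdot e=eH\cdot e$ and $\varepsilon\cdot e=1$. $\mathbf{H}$ is a bimonad with mixed distributive law $\lambda$ if $\varepsilon\cdot m=\varepsilon\cdot H\varepsilon$, $\delta\cdot e=eH\cdot e$, $\varepsilon\cdot e=1$, $\lambda$ is a mixed distributive law from the monad to the comonad, and $\delta\cdot m=Hm\cdot\lambda H\cdot H\delta$. *)

(* Defs.v *)
Set Implicit Arguments.
Unset Strict Implicit.
Unset Printing Implicit Defensive.

Declare Scope cat_scope.
Delimit Scope cat_scope with cat.
Local Open Scope cat_scope.

Record category := Category {
  obj :> Type;
  hom : obj -> obj -> Type;
  idm : forall X, hom X X;
  comp : forall X Y Z, hom Y Z -> hom X Y -> hom X Z;
  comp_idl : forall X Y (f : hom X Y), comp (idm Y) f = f;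
  comp_idr : forall X Y (f : hom X Y), comp f (idm X) = f;
  comp_assoc : forall W X Y Z (h : hom Y Z) (g : hom X Y) (f : hom W X),
    comp h (comp g f) = comp (comp h g) f
}.

Arguments idm {c} X.
Notation "g ∘ f" := (comp g f) (at level 40, left associativity) : cat_scope.

(* The data of a functor are separated from the functor laws, and have
   primitive projections, so that composition of functors is associative and
   unital up to conversion: natural transformations are indexed by these data,
   hence no associators or unitors are needed to write equations between them. *)
#[local] Set Primitive Projections.
Record prefunctor (C D : category) := Prefunctor {
  fobj :> C -> D;
  fmap : forall X Y : C, hom X Y -> hom (fobj X) (fobj Y)
}.
#[local] Unset Primitive Projections.

Arguments fmap {C D} p {X Y} f.

Record functor (C D : category) := Functor {
  fdata :> prefunctor C D;
  fmap_id : forall X : C, fmap fdata (idm X) = idm (fdata X);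
  fmap_comp : forall (X Y Z : C) (g : hom Y Z) (f : hom X Y),
    fmap fdata (g ∘ f) = fmap fdata g ∘ fmap fdata f
}.

Definition pre_id (C : category) : prefunctor C C :=
  {| fobj := fun X => X; fmap := fun X Y f => f |}.

Definition pre_comp (C D E : category)
    (G : prefunctor D E) (F : prefunctor C D) : prefunctor C E :=
  {| fobj := fun X => G (F X); fmap := fun X Y f => fmap G (fmap F f) |}.

Notation "G ⊚ F" := (pre_comp G F) (at level 30, right associativity) : cat_scope.

Canonical functor_id (C : category) : functor C C :=
  @Functor C C (pre_id C) (fun X => eq_refl) (fun X Y Z g f => eq_refl).

Lemma pre_comp_id (C D E : category) (G : functor D E) (F : functor C D) (X : C) :
  fmap (G ⊚ F) (idm X) = idm ((G ⊚ F) X).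
Proof. simpl; rewrite fmap_id; apply fmap_id. Qed.

Lemma pre_comp_comp (C D E : category) (G : functor D E) (F : functor C D)
    (X Y Z : C) (g : hom Y Z) (f : hom X Y) :
  fmap (G ⊚ F) (g ∘ f) = fmap (G ⊚ F) g ∘ fmap (G ⊚ F) f.
Proof. simpl; rewrite fmap_comp; apply fmap_comp. Qed.

Canonical functor_comp (C D E : category) (G : functor D E) (F : functor C D) :
  functor C E := Functor (pre_comp_id G F) (@pre_comp_comp C D E G F).

Record nat_trans (C D : category) (F G : prefunctor C D) := NatTrans {
  component :> forall X : C, hom (F X) (G X);
  naturality : forall (X Y : C) (f : hom X Y),
    component Y ∘ fmap F f = fmap G f ∘ component X
}.

Notation "F ⟹ G" := (nat_trans F G) (at level 60, no associativity) : type_scope.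

Lemma nt_id_natural (C D : category) (F : prefunctor C D) (X Y : C) (f : hom X Y) :
  idm (F Y) ∘ fmap F f = fmap F f ∘ idm (F X).
Proof. rewrite comp_idl, comp_idr; reflexivity. Qed.

Definition nt_id (C D : category) (F : prefunctor C D) : F ⟹ F :=
  NatTrans (@nt_id_natural C D F).

Lemma vcomp_natural (C D : category) (F G K : prefunctor C D)
    (β : G ⟹ K) (α : F ⟹ G) (X Y : C) (f : hom X Y) :
  (β Y ∘ α Y) ∘ fmap F f = fmap K f ∘ (β X ∘ α X).
Proof.
rewrite <- comp_assoc, naturality, comp_assoc, naturality, comp_assoc.
reflexivity.
Qed.

Definition vcomp (C D : category) (F G K : prefunctor C D)
    (β : G ⟹ K) (α : F ⟹ G) : F ⟹ K :=
  NatTrans (vcomp_natural β α).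

Notation "β • α" := (vcomp β α) (at level 50, left associativity) : cat_scope.

Lemma whiskl_natural (C D E : category) (H : functor D E) (F G : prefunctor C D)
    (α : F ⟹ G) (X Y : C) (f : hom X Y) :
  fmap H (α Y) ∘ fmap (H ⊚ F) f = fmap (H ⊚ G) f ∘ fmap H (α X).
Proof. simpl; rewrite <- !fmap_comp, naturality; reflexivity. Qed.

Definition whiskl (C D E : category) (H : functor D E) (F G : prefunctor C D)
    (α : F ⟹ G) : H ⊚ F ⟹ H ⊚ G :=
  @NatTrans C E (H ⊚ F) (H ⊚ G) (fun X => fmap H (α X)) (whiskl_natural H α).

Definition whiskr (C D E : category) (F G : prefunctor D E)
    (α : F ⟹ G) (H : prefunctor C D) : F ⊚ H ⟹ G ⊚ H :=
  @NatTrans C E (F ⊚ H) (G ⊚ H) (fun X => α (H X))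
    (fun X Y f => naturality α (fmap H f)).

Notation "H ◁ α" := (whiskl H α) (at level 35, right associativity) : cat_scope.
Notation "α ▷ H" := (whiskr α H) (at level 34, left associativity) : cat_scope.

Definition hcomp (C D E : category) (F : functor D E) (F' : prefunctor D E)
    (G G' : prefunctor C D) (α : F ⟹ F') (β : G ⟹ G') : F ⊚ G ⟹ F' ⊚ G' :=
  (α ▷ G') • (F ◁ β).

Notation "α ⋆ β" := (hcomp α β) (at level 36, no associativity) : cat_scope.

Record monad (A : category) (H : functor A A) := Monad {
  mon_mult : H ⊚ H ⟹ H;
  mon_unit : pre_id A ⟹ H;
  mult_assoc : mon_mult • (mon_mult ▷ H) = mon_mult • (H ◁ mon_mult);
  mult_unitl : mon_mult • (mon_unit ▷ H) = nt_id H;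
  mult_unitr : mon_mult • (H ◁ mon_unit) = nt_id H
}.

Record comonad (A : category) (H : functor A A) := Comonad {
  comon_comult : H ⟹ H ⊚ H;
  comon_counit : H ⟹ pre_id A;
  comult_coassoc : (comon_comult ▷ H) • comon_comult = (H ◁ comon_comult) • comon_comult;
  comult_counitl : (comon_counit ▷ H) • comon_comult = nt_id H;
  comult_counitr : (H ◁ comon_counit) • comon_comult = nt_id H
}.

Record mixed_law_monad_comonad (A : category) (H : functor A A)
    (M : monad H) (W : comonad H) (λ : H ⊚ H ⟹ H ⊚ H) : Prop :=
  MixedLawMonadComonad {
    mlmc_unit : λ • (mon_unit M ▷ H) = H ◁ mon_unit M;
    mlmc_counit : (comon_counit W ▷ H) • λ = H ◁ comon_counit W;
    mlmc_comult :
      (comon_comult W ▷ H) • λ = (H ◁ λ) • (λ ▷ H) • (H ◁ comon_comult W);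
    mlmc_mult :
      λ • (mon_mult M ▷ H) = (H ◁ mon_mult M) • (λ ▷ H) • (H ◁ λ)
  }.

Record mixed_law_comonad_monad (A : category) (H : functor A A)
    (M : monad H) (W : comonad H) (λ : H ⊚ H ⟹ H ⊚ H) : Prop :=
  MixedLawComonadMonad {
    mlcm_unit : λ • (H ◁ mon_unit M) = mon_unit M ▷ H;
    mlcm_counit : (H ◁ comon_counit W) • λ = comon_counit W ▷ H;
    mlcm_comult :
      (H ◁ comon_comult W) • λ = (λ ▷ H) • (H ◁ λ) • (comon_comult W ▷ H);
    mlcm_mult :
      λ • (H ◁ mon_mult M) = (mon_mult M ▷ H) • (H ◁ λ) • (λ ▷ H)
  }.

Definition double_entwining (A : category) (H : functor A A)
    (M : monad H) (W : comonad H) (τ : H ⊚ H ⟹ H ⊚ H) : Prop :=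
  mixed_law_monad_comonad M W τ /\ mixed_law_comonad_monad M W τ.

(* Only meaningful when τ is a double entwining, which is assumed separately. *)
Record tau_bimonad (A : category) (H : functor A A)
    (M : monad H) (W : comonad H) (τ : H ⊚ H ⟹ H ⊚ H) : Prop := TauBimonad {
  tb_comult_mult :
    comon_comult W • mon_mult M =
      (mon_mult M ⋆ mon_mult M) • (H ◁ τ ▷ H) • (comon_comult W ⋆ comon_comult W);
  tb_counit_mult : comon_counit W • mon_mult M = comon_counit W • (H ◁ comon_counit W);
  tb_comult_unit : comon_comult W • mon_unit M = (mon_unit M ▷ H) • mon_unit M;
  tb_counit_unit : comon_counit W • mon_unit M = nt_id (pre_id A)
}.

Record mixed_bimonad (A : category) (H : functor A A)
    (M : monad H) (W : comonad H) (λ : H ⊚ H ⟹ H ⊚ H) : Prop := MixedBimonad {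
  mb_counit_mult : comon_counit W • mon_mult M = comon_counit W • (H ◁ comon_counit W);
  mb_comult_unit : comon_comult W • mon_unit M = (mon_unit M ▷ H) • mon_unit M;
  mb_counit_unit : comon_counit W • mon_unit M = nt_id (pre_id A);
  mb_law : mixed_law_monad_comonad M W λ;
  mb_comult_mult :
    comon_comult W • mon_mult M = (H ◁ mon_mult M) • (λ ▷ H) • (H ◁ comon_comult W)
}.

Definition tau_tilde (A : category) (H : functor A A)
    (M : monad H) (W : comonad H) (τ : H ⊚ H ⟹ H ⊚ H) : H ⊚ H ⟹ H ⊚ H :=
  (mon_mult M ▷ H) • (H ◁ τ) • (comon_comult W ▷ H).

(* Main.v *)
Require Import Defs.
From Stdlib Require Import FunctionalExtensionality ProofIrrelevance.
Set Implicit Arguments.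
Unset Strict Implicit.
Local Open Scope cat_scope.

(** Read natural transformations between powers of H as string diagrams, with
    vertical composition as composition, so that whiskering with H adds a strand
    and naturality is the rule that operations on disjoint groups of strands
    commute.  The eight axioms of a double entwining then say that a strand can
    be pulled through m, e, δ and ε across τ, from either side: τ behaves like
    a braiding as far as these four operations can see.

    In these terms τ̃ = (m⊗1)(1⊗τ)(δ⊗1) is the map x⊗y ↦ x₁y⊗x₂ of a bialgebra,
    with y carried across x₂ by τ, and the proof is the classical one for
    bialgebras.

    For the unit and counit, e is a coalgebra map and ε is an algebra map, so
    the auxiliary strand produced by δ or consumed by m disappears
    ([tau_tilde_unit], [tau_tilde_counit]).

    For the multiplication, both sides reduce to
      (m⊗m)(m⊗1⊗1⊗1)(1⊗1⊗τ⊗1)(1⊗τ⊗τ)(δ⊗δ⊗1):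
    on the left by the compatibility of δ with m and by pulling τ through a
    product in its first argument; on the right by pulling it through a product
    in its second argument and using associativity of m
    ([tau_tilde_mult]).  The comultiplication axiom is the mirror image, with
    coassociativity in place of associativity ([tau_tilde_comult]).

    Finally, the compatibility δm = (1⊗m)(τ̃⊗1)(1⊗δ) is the τ-bimonad axiom with
    m⊗m and δ⊗δ factored the right way ([tau_tilde_comult_mult]). *)

(** * Equations between natural transformations, componentwise *)

(** A natural transformation carries its naturality proof, so extensionality
    takes proof irrelevance on top of functional extensionality. *)
Lemma nat_trans_ext (C D : category) (F G : prefunctor C D) (α β : F ⟹ G) :
  (forall X, α X = β X) -> α = β.
Proof.
destruct α as [a na], β as [b nb]; simpl; intros E.
assert (Eab : a = b) by (apply functional_extensionality_dep; exact E).
destruct Eab; f_equal; apply proof_irrelevance.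
Qed.

Lemma component_eq (C D : category) (F G : prefunctor C D) (α β : F ⟹ G) :
  α = β -> forall X, α X = β X.
Proof. intros E X; rewrite E; reflexivity. Qed.

Lemma comp_eq_after (C : category) (W X Y Z : C)
    (g : hom Y Z) (f : hom X Y) (h : hom X Z) (k : hom Z W) :
  g ∘ f = h -> k ∘ g ∘ f = k ∘ h.
Proof. intros E; rewrite <- comp_assoc, E; reflexivity. Qed.

(* The type inferred for a unit or counit may mention Id ⊚ H in place of the
   convertible H; syntactic rewriting needs a single form. *)
Ltac strip_identities :=
  repeat match goal with
  | |- context [pre_comp (pre_id ?C) ?F] => change (pre_comp (pre_id C) F) with F
  end.

(* Turns an equation of components into one between left-associated composites of
   arrows fmap H (.. (fmap H (α Y))): one such arrow is one node of the string
   diagram, with a strand to its left for each fmap and the rest to its right. *)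
Ltac flatten :=
  cbn; strip_identities; rewrite ?fmap_comp, ?fmap_id, ?comp_assoc, ?comp_idl, ?comp_idr.

(* Rewriting modulo associativity, for equations whose left-hand side is a
   composite of two arrows: these are consecutive in a left-associated composite
   either at its far left or after some prefix. *)
Ltac step E :=
  let e := fresh in
  pose proof E as e; revert e; cbn; strip_identities; intros e;
  rewrite ?fmap_comp, ?fmap_id in e;
  first [ rewrite (comp_eq_after _ e) | rewrite e ]; clear e;
  rewrite ?comp_assoc, ?comp_idl, ?comp_idr.

(** * The axioms for the composite law *)

(** Since δe = e⊗e, the first leg meets m as a unit while τ carries the incoming
    strand across the second. *)
Lemma tau_tilde_unit (A : category) (H : functor A A)
    (M : monad H) (W : comonad H) (τ : H ⊚ H ⟹ H ⊚ H) :
  τ • (mon_unit M ▷ H) = H ◁ mon_unit M ->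
  comon_comult W • mon_unit M = (mon_unit M ▷ H) • mon_unit M ->
  tau_tilde M W τ • (mon_unit M ▷ H) = H ◁ mon_unit M.
Proof.
intros Eτ Eδ; apply nat_trans_ext; intros X; flatten.
step (component_eq Eδ (H X)).
step (eq_sym (naturality (mon_unit M) (τ X))).
step (component_eq (mult_unitl M) (H X)).
step (component_eq Eτ X).
reflexivity.
Qed.

(** Since εm = ε⊗ε, the strand that τ sends to the left is counted out; this
    amounts to counting out the second argument before τ, and the counit law
    then removes δ. *)
Lemma tau_tilde_counit (A : category) (H : functor A A)
    (M : monad H) (W : comonad H) (τ : H ⊚ H ⟹ H ⊚ H) :
  (comon_counit W ▷ H) • τ = H ◁ comon_counit W ->
  comon_counit W • mon_mult M = comon_counit W • (H ◁ comon_counit W) ->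
  (comon_counit W ▷ H) • tau_tilde M W τ = H ◁ comon_counit W.
Proof.
intros Eτ Eε; apply nat_trans_ext; intros X; flatten.
step (component_eq Eε (H X)).
step (f_equal (fmap H) (component_eq Eτ X)).
step (naturality (comon_counit W) (fmap H (comon_counit W X))).
step (component_eq (comult_counitl W) (H X)).
reflexivity.
Qed.

(** The two sides multiply the same diagram: a product in the first argument of
    τ̃ turns into two crossings because τ passes m in its first argument, two
    successive τ̃ because τ passes m in its second argument. *)
Lemma tau_tilde_mult (A : category) (H : functor A A)
    (M : monad H) (W : comonad H) (τ : H ⊚ H ⟹ H ⊚ H) :
  τ • (mon_mult M ▷ H) = (H ◁ mon_mult M) • (τ ▷ H) • (H ◁ τ) ->
  τ • (H ◁ mon_mult M) = (mon_mult M ▷ H) • (H ◁ τ) • (τ ▷ H) ->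
  comon_comult W • mon_mult M =
    (mon_mult M ⋆ mon_mult M) • (H ◁ τ ▷ H) • (comon_comult W ⋆ comon_comult W) ->
  tau_tilde M W τ • (mon_mult M ▷ H) =
    (H ◁ mon_mult M) • (tau_tilde M W τ ▷ H) • (H ◁ tau_tilde M W τ).
Proof.
intros El Er Eδ; apply nat_trans_ext; intros X; flatten.
(* The left side, up to putting the two crossings in the order of the right. *)
step (component_eq Eδ (H X)).
step (eq_sym (naturality (mon_mult M) (τ X))).
step (f_equal (fmap (H ⊚ H)) (component_eq El X)).
step (f_equal (fmap H) (eq_sym (naturality τ (τ X)))).
(* The right side: both δ are moved to the bottom. *)
step (naturality (comon_comult W) (mon_mult M (H X))).
step (naturality (comon_comult W) (fmap H (τ X))).
step (f_equal (fmap H) (component_eq Er (H X))).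
(* The products of the first three strands differ by associativity. *)
step (eq_sym (naturality (mon_mult M) (mon_mult M X))).
step (f_equal (fmap H) (eq_sym (naturality (mon_mult M) (mon_mult M X)))).
step (eq_sym (component_eq (mult_assoc M) (H X))).
reflexivity.
Qed.

(** The upside-down version of [tau_tilde_mult]: δ after τ̃ passes τ in one
    argument, and the δ inside the second τ̃ passes the τ of the first in the
    other argument. *)
Lemma tau_tilde_comult (A : category) (H : functor A A)
    (M : monad H) (W : comonad H) (τ : H ⊚ H ⟹ H ⊚ H) :
  (comon_comult W ▷ H) • τ = (H ◁ τ) • (τ ▷ H) • (H ◁ comon_comult W) ->
  (H ◁ comon_comult W) • τ = (τ ▷ H) • (H ◁ τ) • (comon_comult W ▷ H) ->
  comon_comult W • mon_mult M =
    (mon_mult M ⋆ mon_mult M) • (H ◁ τ ▷ H) • (comon_comult W ⋆ comon_comult W) ->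
  (comon_comult W ▷ H) • tau_tilde M W τ =
    (H ◁ tau_tilde M W τ) • (tau_tilde M W τ ▷ H) • (H ◁ comon_comult W).
Proof.
intros El Er Eδ; apply nat_trans_ext; intros X; flatten.
(* The left side, with all δ moved to the bottom. *)
step (component_eq Eδ (H X)).
step (f_equal (fmap H) (component_eq El X)).
step (naturality (comon_comult W) (fmap H (τ X))).
step (naturality (comon_comult W) (τ (H X))).
step (naturality (comon_comult W) (fmap H (comon_comult W X))).
(* The right side, with both m moved to the top. *)
step (eq_sym (naturality (mon_mult M) (comon_comult W (H X)))).
step (eq_sym (naturality (mon_mult M) (fmap H (τ X)))).
step (eq_sym (naturality (mon_mult M) (mon_mult M (H X)))).
step (f_equal (fmap H) (component_eq Er (H X))).
step (f_equal (fmap H) (eq_sym (naturality τ (τ X)))).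
(* The two δ on the first strand differ by coassociativity. *)
step (eq_sym (component_eq (comult_coassoc W) (H (H X)))).
step (naturality (comon_comult W) (comon_comult W X)).
step (naturality (comon_comult W) (fmap H (comon_comult W X))).
reflexivity.
Qed.

(** Both sides are the same diagram; they differ in which of two m on disjoint
    strands comes first. *)
Lemma tau_tilde_comult_mult (A : category) (H : functor A A)
    (M : monad H) (W : comonad H) (τ : H ⊚ H ⟹ H ⊚ H) :
  comon_comult W • mon_mult M =
    (mon_mult M ⋆ mon_mult M) • (H ◁ τ ▷ H) • (comon_comult W ⋆ comon_comult W) ->
  comon_comult W • mon_mult M =
    (H ◁ mon_mult M) • (tau_tilde M W τ ▷ H) • (H ◁ comon_comult W).
Proof.
intros Eδ; rewrite Eδ; apply nat_trans_ext; intros X; flatten.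
step (naturality (mon_mult M) (mon_mult M X)).
reflexivity.
Qed.

Theorem proposition6p3 (A : category) (H : functor A A)
    (M : monad H) (W : comonad H) (τ : H ⊚ H ⟹ H ⊚ H)
    (hτ : double_entwining M W τ) (hH : tau_bimonad M W τ) :
  mixed_law_monad_comonad M W (tau_tilde M W τ) /\
  mixed_bimonad M W (tau_tilde M W τ).
Proof.
destruct hτ as [[τe ετ δτ τm] [_ _ δτ' τm']], hH as [δm εm δe εe].
assert (law : mixed_law_monad_comonad M W (tau_tilde M W τ)).
{ split.
  - exact (tau_tilde_unit τe δe).
  - exact (tau_tilde_counit ετ εm).
  - exact (tau_tilde_comult δτ δτ' δm).
  - exact (tau_tilde_mult τm τm' δm). }
split; [exact law | split; try assumption].
exact (tau_tilde_comult_mult δm).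
Qed.
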